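(* Let $\kappa\in\mathbb{R}$, $\kappa\neq 0$, and let $\lambda_*\in\{i\sqrt{2}|\kappa|,\,-i\sqrt{2}|\kappa|\}$. Then a function $\lambda\mapsto\nu_\kappa(\lambda)$ satisfying $$\nu_\kappa(\lambda)^2=-\lambda^2-2\kappa^2$$ cannot be analytic in a neighbourhood of $\lambda_*$; that is, there do not exist an open set $U\subset\mathbb{C}$ containing $\lambda_*$ and an analytic function $\nu_\kappa:U\to\mathbb{C}$ such that $\nu_\kappa(\lambda)^2=-\lambda^2-2\kappa^2$ for all $\lambda\in U$. *)

(* Defs.v *)
From Stdlib Require Import Reals.
From Coquelicot Require Import Coquelicot.

Open Scope R_scope.
Open Scope C_scope.

(* Complex analyticity: [f] is the sum of a convergent power series with complex
   coefficients, [f z = sum_k a k * (z - z0) ^ k], on some disc around [z0].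
   Coquelicot's [PSeries] is real, but [is_pseries] is generic in the base ring. *)
Definition analytic_at (f : C -> C) (z0 : C) : Prop :=
  exists (a : nat -> C) (r : R),
    (0 < r)%R /\
    forall z : C, (Cmod (z - z0) < r)%R ->
      @is_pseries C_AbsRing C_NormedModule a (z - z0) (f z).

(* A function [U -> C] is represented by a total function [C -> C] whose values
   outside [U] are irrelevant: for [U] open the discs above can be shrunk into [U]. *)
Definition analytic_on (U : C -> Prop) (f : C -> C) : Prop :=
  forall z : C, U z -> analytic_at f z.

(* Main.v *)
Require Import Defs.
From Stdlib Require Import Reals Lra.
From Coquelicot Require Import Coquelicot.

(** If [nu] is analytic at [lambda_star], then it is Lipschitz there. Since
    [nu lambda_star = 0] and [- lambda ^ 2 - 2 kappa ^ 2] factors as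
    [- h (h + 2 lambda_star)] with [h = lambda - lambda_star], the Lipschitz bound gives
    [|h| |h + 2 lambda_star| <= M ^ 2 |h| ^ 2] for small [h], which forces
    [lambda_star = 0]. *)

Open Scope R_scope.
Open Scope C_scope.

Lemma Cmod_pseries_term (a : nat -> C) (h : C) (n : nat) :
  norm (@scal C_AbsRing C_NormedModule (pow_n h n) (a n)) = (Cmod h ^ n * Cmod (a n))%R.
Proof.
  replace (@pow_n C_Ring h n) with (h ^ n).
  - change (Cmod (h ^ n * a n) = (Cmod h ^ n * Cmod (a n))%R).
    now rewrite Cmod_mult, Cmod_pow.
  - induction n as [|n IH]; [reflexivity|].
    change (h * h ^ n = h * @pow_n C_Ring h n). now rewrite IH.
Qed.

(** Convergent partial sums are bounded, and every term after the first is a difference of two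
    consecutive partial sums. *)
Lemma is_series_terms_bounded {K : AbsRing} {V : NormedModule K} (u : nat -> V) (l : V) :
  is_series u l -> exists M : R, forall n, norm (u n) <= M.
Proof.
  intros Hu.
  destruct (filterlim_bounded (sum_n u)) as [M HM]; [now exists l|].
  exists (M + M)%R. intros [|n].
  - generalize (HM 0%nat) (norm_ge_0 (sum_n u 0)). rewrite sum_O. lra.
  - replace (u (S n)) with (minus (sum_n u (S n)) (sum_n u n)).
    + unfold minus. eapply Rle_trans; [apply norm_triangle|].
      rewrite norm_opp. generalize (HM n) (HM (S n)). lra.
    + rewrite sum_Sn. unfold minus.
      rewrite (plus_comm (sum_n u n)), <- plus_assoc.
      etransitivity; [apply f_equal, plus_opp_r|apply plus_zero_r].
Qed.

(** Put [t = |h| / rho <= 1/2]. The term of index [n] has modulus at most [B t^n], so the series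
    without its constant term is dominated by a geometric series of sum at most [2 B t]. *)
Lemma is_pseries_Cmod_sub_le (a : nat -> C) (rho B : R) (h l : C) :
  0 < rho -> (forall n, (rho ^ n * Cmod (a n))%R <= B) -> Cmod h <= (rho / 2)%R ->
  @is_pseries C_AbsRing C_NormedModule a h l ->
  Cmod (l - a 0%nat) <= (2 * B / rho * Cmod h)%R.
Proof.
  intros Hrho HB Hh Hl.
  set (S := @sum_n C_NormedModule
              (fun k => @scal C_AbsRing C_NormedModule (pow_n h k) (a k))).
  set (t := (Cmod h / rho)%R).
  assert (Ht : Cmod h = (rho * t)%R) by (unfold t; field; lra).
  assert (Ht0 : (0 <= t)%R).
  { apply Rmult_le_pos; [apply Cmod_ge_0|]. left. now apply Rinv_0_lt_compat. }
  assert (Ht2 : (t <= / 2)%R) by (apply Rmult_le_reg_l with rho; lra).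
  assert (HB0 : (0 <= B)%R).
  { generalize (HB 0%nat) (Cmod_ge_0 (a 0%nat)). simpl. lra. }
  (* One factor [t] is kept, so that the final bound is linear in [|h|]; the others are replaced by
     [1/2]. *)
  assert (Hpow : forall n, (t ^ (Datatypes.S n) <= t * (/ 2) ^ n)%R).
  { intros n. simpl. apply Rmult_le_compat_l; [easy|]. now apply pow_incr. }
  (* The right-hand side is the exact sum of [B t (1/2)^k] over [k < n], which lets the induction
     close. *)
  assert (HS : forall n, Cmod (S n - a 0%nat) <= (2 * B * t * (1 - (/ 2) ^ n))%R).
  { induction n as [|n IH].
    - unfold S. rewrite sum_O.
      replace (@scal C_AbsRing C_NormedModule (pow_n h 0) (a 0%nat)) with (a 0%nat)
        by (symmetry; apply (@scal_one C_AbsRing C_NormedModule)).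
      replace (a 0%nat - a 0%nat) with (RtoC 0) by ring.
      rewrite Cmod_0. simpl. lra.
    - unfold S. rewrite sum_Sn. fold (S n).
      set (v := @scal C_AbsRing C_NormedModule (pow_n h (Datatypes.S n)) (a (Datatypes.S n))).
      change (Cmod ((S n + v) - a 0%nat) <= (2 * B * t * (1 - (/ 2) ^ Datatypes.S n))%R).
      replace ((S n + v) - a 0%nat) with ((S n - a 0%nat) + v) by ring.
      eapply Rle_trans; [apply Cmod_triangle|].
      assert (Hv : Cmod v <= (t * (/ 2) ^ n * B)%R).
      { eapply Rle_trans; [apply Req_le, (Cmod_pseries_term a h (Datatypes.S n))|].
        rewrite Ht, Rpow_mult_distr.
        replace (rho ^ Datatypes.S n * t ^ Datatypes.S n * Cmod (a (Datatypes.S n)))%R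
          with (t ^ Datatypes.S n * (rho ^ Datatypes.S n * Cmod (a (Datatypes.S n))))%R by ring.
        apply Rmult_le_compat; auto.
        - now apply pow_le.
        - apply Rmult_le_pos; [apply pow_le; lra|apply Cmod_ge_0]. }
      simpl. lra. }
  (* The modulus is continuous, so the uniform bound on the partial sums passes to [l]. *)
  assert (Hlim : is_lim_seq (fun n => Cmod (S n - a 0%nat)) (Cmod (l - a 0%nat))).
  { apply (filterlim_comp _ _ _ (fun n => S n - a 0%nat) Cmod _
             (@locally C_NormedModule (l - a 0%nat))).
    - apply (filterlim_comp_2 (H := @locally C_NormedModule (- a 0%nat))
               S (fun _ => - a 0%nat) Cplus Hl).
      + apply filterlim_const.
      + apply (@filterlim_plus C_AbsRing C_NormedModule).
    - apply (@filterlim_norm C_AbsRing C_NormedModule). }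
  replace (2 * B / rho * Cmod h)%R with (2 * B * t)%R by (unfold t; field; lra).
  apply (is_lim_seq_le (fun n => Cmod (S n - a 0%nat)) (fun _ => 2 * B * t)%R
           (Cmod (l - a 0%nat)) (2 * B * t)%R);
    [|exact Hlim|apply is_lim_seq_const].
  intros n. eapply Rle_trans; [apply HS|].
  assert (0 <= B * t)%R by now apply Rmult_le_pos.
  assert (0 <= (/ 2) ^ n)%R by (apply pow_le; lra).
  assert (0 <= B * t * (/ 2) ^ n)%R by now apply Rmult_le_pos.
  lra.
Qed.

(** Convergence at the single point [z0 + r/2], inside the disc, bounds [rho^n |a n|] for
    [rho = r/2]; the geometric estimate then applies on the disc of radius [rho/2]. *)
Lemma analytic_at_lipschitz (f : C -> C) (z0 : C) :
  analytic_at f z0 ->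
  exists M d : R, (0 < d)%R /\
    forall z, Cmod (z - z0) <= d -> Cmod (f z - f z0) <= (M * Cmod (z - z0))%R.
Proof.
  intros (a & r & Hr & Hf).
  set (rho := (r / 2)%R).
  assert (Hrho : (0 < rho)%R) by (unfold rho; lra).
  assert (Hmod : Cmod (RtoC rho) = rho) by (rewrite Cmod_R; apply Rabs_pos_eq; lra).
  assert (Hser := Hf (z0 + RtoC rho)).
  replace (z0 + RtoC rho - z0) with (RtoC rho) in Hser by ring.
  destruct (is_series_terms_bounded _ _ (Hser ltac:(rewrite Hmod; unfold rho; lra)))
    as [B HB].
  assert (Hsub : forall z, Cmod (z - z0) <= (rho / 2)%R ->
            Cmod (f z - a 0%nat) <= (2 * B / rho * Cmod (z - z0))%R).
  { intros z Hz. apply is_pseries_Cmod_sub_le; auto.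
    - intros n. specialize (HB n). rewrite Cmod_pseries_term, Hmod in HB. exact HB.
    - apply Hf. unfold rho in Hz. lra. }
  (* At [z = z0] the bound [Hsub] has right-hand side zero. *)
  assert (Ha : f z0 = a 0%nat).
  { assert (Hz := Hsub z0). replace (z0 - z0) with (RtoC 0) in Hz by ring.
    rewrite Cmod_0, Rmult_0_r in Hz.
    replace (f z0) with ((f z0 - a 0%nat) + a 0%nat) by ring.
    rewrite (Cmod_eq_0 (f z0 - a 0%nat)); [ring|].
    apply Rle_antisym; [apply Hz; lra|apply Cmod_ge_0]. }
  exists (2 * B / rho)%R, (rho / 2)%R. rewrite Ha. split; [lra|exact Hsub].
Qed.

(** Writing the constant as [z0 ^ 2] treats both signs of the branch point at once. *)
Lemma no_analytic_sqrt_at_simple_zero (U : C -> Prop) (nu : C -> C) (z0 : C) :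
  z0 <> 0 -> open U -> U z0 -> analytic_at nu z0 ->
  ~ forall z, U z -> nu z ^ 2 = - z ^ 2 + z0 ^ 2.
Proof.
  intros Hz0 HU Uz0 Han Hnu.
  destruct (analytic_at_lipschitz nu z0 Han) as (M & d & Hd & HM).
  destruct (HU z0 Uz0) as [e He].
  apply Cmod_gt_0 in Hz0.
  assert (HM1 : (0 < M * M + 1)%R) by (generalize (Rle_0_sqr M); unfold Rsqr; lra).
  (* The test point is [z0 + x]: [d] keeps it in the range of the Lipschitz bound, [e / 2] keeps it
     in [U], and the last term makes [(M^2 + 1) x <= |z0|]. The [+ 1] keeps the denominator positive
     and absorbs the [x] lost in [Htri]. *)
  set (x := Rmin (Rmin d (e / 2)) (Cmod z0 / (M * M + 1))).
  assert (Hx : (0 < x)%R).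
  { destruct e as [e He0]; simpl in *.
    repeat apply Rmin_pos; [lra|lra|now apply Rdiv_lt_0_compat]. }
  assert (Hxd : (x <= d)%R).
  { eapply Rle_trans; [apply Rmin_l|apply Rmin_l]. }
  assert (Hxe : (x < e)%R).
  { apply Rle_lt_trans with (e / 2)%R.
    - eapply Rle_trans; [apply Rmin_l|apply Rmin_r].
    - destruct e as [e He0]; simpl in *; lra. }
  assert (HxM : ((M * M + 1) * x <= Cmod z0)%R).
  { replace (Cmod z0) with ((M * M + 1) * (Cmod z0 / (M * M + 1)))%R by (field; lra).
    apply Rmult_le_compat_l; [lra|apply Rmin_r]. }
  set (z := z0 + RtoC x).
  assert (Hzz0 : z - z0 = RtoC x) by (unfold z; ring).
  assert (Hmod : Cmod (RtoC x) = x) by (rewrite Cmod_R; apply Rabs_pos_eq; lra).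
  assert (Uz : U z).
  (* [open] refers to product balls in the two coordinates; the modulus ball of radius [e] lies
     inside the product ball. *)
  { apply He, C_NormedModule_mixin_compat1.
    change (Cmod (z - z0) < e). now rewrite Hzz0, Hmod. }
  assert (Hnu0 : nu z0 = 0).
  { apply Cmod_eq_0.
    assert (Hsq : Cmod (nu z0 ^ 2) = 0%R).
    { rewrite (Hnu z0 Uz0), <- Cmod_0. f_equal. ring. }
    rewrite Cmod_pow in Hsq. apply Rsqr_0_uniq. unfold Rsqr. simpl in Hsq. lra. }
  assert (Hlip : (Cmod (nu z) <= M * x)%R).
  { generalize (HM z). rewrite Hzz0, Hmod, Hnu0.
    replace (nu z - 0) with (nu z) by ring. auto. }
  assert (Hfac : (Cmod (nu z) ^ 2 = x * Cmod (RtoC x + 2 * z0))%R).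
  { rewrite <- Cmod_pow, (Hnu z Uz), <- Hmod at 1.
    rewrite <- Cmod_mult, <- Cmod_opp. f_equal. unfold z. ring. }
  assert (Htri : (2 * Cmod z0 <= Cmod (RtoC x + 2 * z0) + x)%R).
  { replace (2 * Cmod z0)%R with (Cmod (2 * z0)).
    - replace (2 * z0) with ((RtoC x + 2 * z0) + - RtoC x) at 1 by ring.
      eapply Rle_trans; [apply Cmod_triangle|]. rewrite Cmod_opp, Hmod. lra.
    - rewrite Cmod_mult, Cmod_R, Rabs_pos_eq; lra. }
  assert (Hsq : (Cmod (nu z) ^ 2 <= (M * x) ^ 2)%R).
  { apply pow_incr. split; [apply Cmod_ge_0|easy]. }
  assert (Hbd : (Cmod (RtoC x + 2 * z0) <= M * M * x)%R).
  { apply Rmult_le_reg_l with x; [easy|]. rewrite <- Hfac. simpl in *. lra. }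
  (* Together, [2 |z0| <= M^2 x + x <= |z0|], against [|z0| > 0]. *)
  lra.
Qed.

Theorem lemma4p2 (kappa : R) (hkappa : kappa <> 0%R) (lambda_star : C)
    (hlambda : lambda_star = Ci * RtoC (sqrt 2) * RtoC (Rabs kappa) \/
               lambda_star = - (Ci * RtoC (sqrt 2) * RtoC (Rabs kappa))) :
  ~ exists (U : C -> Prop) (nu : C -> C),
      open U /\ U lambda_star /\ analytic_on U nu /\
      forall lambda : C, U lambda ->
        (nu lambda ^ 2 = - lambda ^ 2 - 2 * RtoC kappa ^ 2).
Proof.
  intros (U & nu & HU & Ul & Han & Hnu).
  assert (Hk : (kappa ^ 2 <> 0)%R) by now apply pow_nonzero.
  (* Either sign gives the same square, so [- 2 kappa^2] is [lambda_star ^ 2], which is nonzero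
     because [kappa] is. *)
  assert (Hsq : lambda_star ^ 2 = RtoC (- (2 * kappa ^ 2))%R).
  { replace (lambda_star ^ 2)
      with (Ci * Ci * RtoC (sqrt 2 * sqrt 2 * (Rabs kappa * Rabs kappa))%R).
    - rewrite sqrt_sqrt by lra.
      rewrite <- Rabs_mult, Rabs_pos_eq by apply Rle_0_sqr.
      apply injective_projections; simpl; ring.
    - rewrite !RtoC_mult. destruct hlambda as [-> | ->]; ring. }
  apply (no_analytic_sqrt_at_simple_zero U nu lambda_star); auto.
  - intros H0. apply Hk. rewrite H0 in Hsq. apply (f_equal fst) in Hsq.
    simpl in *. lra.
  - intros z Uz. rewrite (Hnu z Uz), Hsq, RtoC_opp, RtoC_mult, RtoC_pow. ring.
Qed.
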